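(* Let $\mathcal T$ be a $C^*$-precategory. (1) If $\mathcal K$ is an ideal in $\mathcal T$, then for all objects $\sigma,\rho$ of $\mathcal T$ $$\mathcal K(\sigma,\rho)=\{a\in\mathcal T(\sigma,\rho): a^*a\in\mathcal K(\rho,\rho)\}=\{a\in\mathcal T(\sigma,\rho): aa^*\in\mathcal K(\sigma,\sigma)\}.\qquad( * )$$ (2) Conversely, if $\{\mathcal K(\rho,\rho)\}_{\rho\in\mathcal T}$ is a class where each $\mathcal K(\rho,\rho)$ is a closed two-sided ideal in the $C^*$-algebra $\mathcal T(\rho,\rho)$, and $$\{a\in\mathcal T(\sigma,\rho): a^*a\in\mathcal K(\rho,\rho)\}=\{a\in\mathcal T(\sigma,\rho): aa^*\in\mathcal K(\sigma,\sigma)\}$$ for all objects $\sigma,\rho\in\mathcal T$, then the relations $( * )$ define an ideal $\mathcal K$ in $\mathcal T$.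
   Context: A precategory is defined like a category except that identity morphisms are not required; $\mathcal T(\sigma,\rho)$ denotes the space of morphisms from $\rho$ to $\sigma$, and composition maps $\mathcal T(\tau,\sigma)\times\mathcal T(\sigma,\rho)\ni(a,b)\mapsto ab\in\mathcal T(\tau,\rho)$ associatively. A $C^*$-precategory is a precategory $\mathcal T$ in which each $\mathcal T(\sigma,\rho)$ is a complex Banach space, composition is bilinear with $\|ab\|\le\|a\|\,\|b\|$, and there is an antilinear involutive contravariant functor $*:\mathcal T\to\mathcal T$ (identity on objects, $a\in\mathcal T(\sigma,\rho)\Rightarrow a^*\in\mathcal T(\rho,\sigma)$, $(ab)^*=b^*a^*$, $a^{**}=a$) with $\|a^*a\|=\|a\|^2$. Thus each $\mathcal T(\rho,\rho)$ is a $C^*$-algebra. An ideal $\mathcal K$ in $\mathcal T$ is a collection of closed linear subspaces $\mathcal K(\sigma,\rho)\subset\mathcal T(\sigma,\rho)$ such that $\mathcal T(\tau,\sigma)\mathcal K(\sigma,\rho)\subset\mathcal K(\tau,\rho)$ and $\mathcal K(\tau,\sigma)\mathcal T(\sigma,\rho)\subset\mathcal K(\tau,\rho)$ for all objects $\sigma,\rho,\tau$. *)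

(* Defs.v *)
From mathcomp Require Import all_boot all_order all_algebra.
From mathcomp Require Import complex.
From mathcomp Require Import all_classical all_reals all_analysis.

Set Implicit Arguments.
Unset Strict Implicit.
Unset Printing Implicit Defensive.

Import Order.TTheory GRing.Theory Num.Theory.
Import numFieldNormedType.Exports.
Local Open Scope classical_set_scope.
Local Open Scope ring_scope.
Local Open Scope complex_scope.

(* [mor s r] is the space of morphisms from r to s, so that [mcomp a b] is
   "a after b". Norms take values in R[i], where x <= y forces y - x to be
   real and nonnegative. *)
Record cstar_precategory (R : realType) := CstarPrecategory {
  ob :> Type ;
  mor : ob -> ob -> completeNormedModType R[i] ;
  mcomp : forall t s r : ob, mor t s -> mor s r -> mor t r ;
  mstar : forall s r : ob, mor s r -> mor r s ;
  mcompA : forall (u t s r : ob) (a : mor u t) (b : mor t s) (c : mor s r),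
    mcomp a (mcomp b c) = mcomp (mcomp a b) c ;
  mcomp_linearl : forall (t s r : ob) (b : mor s r),
    linear (fun a : mor t s => mcomp a b) ;
  mcomp_linearr : forall (t s r : ob) (a : mor t s),
    linear (fun b : mor s r => mcomp a b) ;
  mcomp_norm : forall (t s r : ob) (a : mor t s) (b : mor s r),
    `|mcomp a b| <= `|a| * `|b| ;
  mstar_antilinear : forall (s r : ob) (c : R[i]) (a b : mor s r),
    mstar (c *: a + b) = Num.conj c *: mstar a + mstar b ;
  mstar_comp : forall (t s r : ob) (a : mor t s) (b : mor s r),
    mstar (mcomp a b) = mcomp (mstar b) (mstar a) ;
  mstarK : forall (s r : ob) (a : mor s r), mstar (mstar a) = a ;
  cstar_norm : forall (s r : ob) (a : mor s r),
    `|mcomp (mstar a) a| = `|a| ^+ 2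
}.

Definition closed_subspace (K : numFieldType) (V : normedModType K)
    (A : set V) : Prop :=
  [/\ A 0, forall (c : K) (x y : V), A x -> A y -> A (c *: x + y) & closed A].

Definition is_ideal (R : realType) (T : cstar_precategory R)
    (K : forall s r : T, set (mor s r)) : Prop :=
  [/\ forall s r : T, closed_subspace (K s r),
      forall (t s r : T) (a : mor t s) (b : mor s r),
        K s r b -> K t r (mcomp a b)
    & forall (t s r : T) (a : mor t s) (b : mor s r),
        K t s a -> K t r (mcomp a b)].

Definition closed_two_sided_ideal (R : realType) (T : cstar_precategory R)
    (r : T) (I : set (mor r r)) : Prop :=
  [/\ closed_subspace I,
      forall a b : mor r r, I b -> I (mcomp a b)
    & forall a b : mor r r, I a -> I (mcomp a b)].

(* Main.v *)
(* The crux is that a closed subspace M of T(s,r) containing h x for every x,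
   where h = z z^*, contains z. Positivity of z z^* is not an axiom; but h is
   self-adjoint, so 1 + ih and 1 - ih act with the same norm, whence
   |y| <= |(1 + h^2) y|, and, iterating 1 - h^4 = (1 + h^2) (1 - h^2), the
   operator P = 1 - h^2 is a contraction when |h| < 1. Each P^i z - z is in M,
   and h^2 (1 + P + ... + P^(n-1)) = 1 - P^n is bounded, so h^2 kills the ergodic
   averages of the P^i in the limit; as h = z z^*, the C*-identity then makes the
   averages of the P^i z tend to 0.
   For part (2) this shows that the candidate K(s,r) is both
   { a | b a in K(r,r) for all b } and { a | a b in K(s,s) for all b }; the
   first form is a closed left ideal, the second a right ideal. *)
Require Import Defs.
From mathcomp Require Import all_boot all_order all_algebra.
From mathcomp Require Import complex.
From mathcomp Require Import all_classical all_reals all_analysis.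
From mathcomp Require Import ring lra.
Import Order.TTheory GRing.Theory Num.Theory.
Import numFieldNormedType.Exports.
Local Open Scope classical_set_scope.
Local Open Scope ring_scope.

(** * Real-valued norms and closedness by approximation *)

Section RealNorm.
Set Implicit Arguments.
Unset Strict Implicit.
Variables (R : realType) (V : normedModType R[i]).
Implicit Types x y : V.

(** Norms in [R[i]] are real, so the real part loses nothing and lands in a totally ordered
    field. *)
Definition rnorm x : R := complex.Re `|x|.

Lemma rnormE x : `|x| = (rnorm x)%:C%C.
Proof.
rewrite /rnorm; have := normr_ge0 x; case: (`|x|) => u v.
by rewrite lecE /= => /andP[/eqP -> _].
Qed.

Lemma rnorm_ge0 x : 0 <= rnorm x.
Proof. by rewrite -ler0c -rnormE. Qed.

Lemma rnormN x : rnorm (- x) = rnorm x.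
Proof. by rewrite /rnorm normrN. Qed.

Lemma rnorm0 : rnorm 0 = 0.
Proof. by rewrite /rnorm normr0. Qed.

Lemma rnormD x y : rnorm (x + y) <= rnorm x + rnorm y.
Proof. by rewrite -lecR rmorphD/= -!rnormE ler_normD. Qed.

Lemma rnormB x y : rnorm (x - y) <= rnorm x + rnorm y.
Proof. by rewrite (le_trans (rnormD _ _))// rnormN. Qed.

Lemma rnormZ (t : R) x : 0 <= t -> rnorm (t%:C%C *: x) = t * rnorm x.
Proof.
move=> t0; apply: complexI.
rewrite rmorphM/= -!rnormE normrZ ger0_norm // ler0c //.
Qed.

(** A positive radius in [R[i]] is automatically real, so real radii suffice. *)
Lemma closed_approx (A : set V) : closed A <->
  forall z, (forall e : R, 0 < e -> exists2 m, A m & rnorm (z - m) < e) -> A z.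
Proof.
split=> [cA z Az|cA z clz].
  apply: cA => B /nbhs_ballP[e /= e0 eB].
  have [e' e'E] : exists e' : R, e = e'%:C%C.
    exists (complex.Re e); move: e0; case: e {eB} => u v.
    by rewrite ltcE /= => /andP[/eqP -> _].
  move: e0 eB; rewrite e'E (ltcR 0) => e0 eB.
  have [m Am zm] := Az _ e0; exists m; split=> //; apply: eB.
  by rewrite -ball_normE /ball_ /= rnormE ltcR.
apply: cA => e e0.
have e0C : (0 : R[i]) < e%:C%C by rewrite (ltcR 0).
have [m [Am]] := clz _ (nbhsx_ballx z _ e0C).
by rewrite -ball_normE /ball_ /= rnormE ltcR => ?; exists m.
Qed.

End RealNorm.

Section Precategory.
Set Implicit Arguments.
Unset Strict Implicit.
Variables (R : realType) (T : cstar_precategory R).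
Implicit Types t s r : T.

(** * Algebra of composition and involution *)

Lemma mcompDl t s r (a a' : mor t s) (b : mor s r) :
  mcomp (a + a') b = mcomp a b + mcomp a' b.
Proof. by have := mcomp_linearl b 1 a a'; rewrite /= !scale1r. Qed.

Lemma mcompDr t s r (a : mor t s) (b b' : mor s r) :
  mcomp a (b + b') = mcomp a b + mcomp a b'.
Proof. by have := mcomp_linearr a 1 b b'; rewrite /= !scale1r. Qed.

Lemma mcomp0l t s r (b : mor s r) : mcomp (0 : mor t s) b = 0.
Proof. by apply: (addrI (mcomp (0 : mor t s) b)); rewrite -mcompDl !addr0. Qed.

Lemma mcomp0r t s r (a : mor t s) : mcomp a (0 : mor s r) = 0.
Proof. by apply: (addrI (mcomp a (0 : mor s r))); rewrite -mcompDr !addr0. Qed.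

Lemma mcompZl t s r c (a : mor t s) (b : mor s r) :
  mcomp (c *: a) b = c *: mcomp a b.
Proof. by have := mcomp_linearl b c a 0; rewrite /= mcomp0l !addr0. Qed.

Lemma mcompZr t s r c (a : mor t s) (b : mor s r) :
  mcomp a (c *: b) = c *: mcomp a b.
Proof. by have := mcomp_linearr a c b 0; rewrite /= mcomp0r !addr0. Qed.

Lemma mcompNl t s r (a : mor t s) (b : mor s r) : mcomp (- a) b = - mcomp a b.
Proof. by rewrite -scaleN1r mcompZl scaleN1r. Qed.

Lemma mcompNr t s r (a : mor t s) (b : mor s r) : mcomp a (- b) = - mcomp a b.
Proof. by rewrite -scaleN1r mcompZr scaleN1r. Qed.

Lemma mstarD s r (a b : mor s r) : mstar (a + b) = mstar a + mstar b.
Proof. by have := mstar_antilinear 1 a b; rewrite rmorph1 !scale1r. Qed.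

Lemma mstar0 s r : mstar (0 : mor s r) = 0.
Proof. by apply: (addrI (mstar (0 : mor s r))); rewrite -mstarD !addr0. Qed.

Lemma mstarZ s r c (a : mor s r) : mstar (c *: a) = Num.conj c *: mstar a.
Proof. by have := mstar_antilinear c a 0; rewrite mstar0 !addr0. Qed.

Lemma mstarN s r (a : mor s r) : mstar (- a) = - mstar a.
Proof. by rewrite -scaleN1r mstarZ rmorphN1 scaleN1r. Qed.

(** * Norm estimates from the C*-identity *)

Lemma rnorm_comp t s r (a : mor t s) (b : mor s r) :
  rnorm (mcomp a b) <= rnorm a * rnorm b.
Proof. by rewrite -lecR rmorphM/= -!rnormE mcomp_norm. Qed.

Lemma rnorm_cstar s r (a : mor s r) : rnorm (mcomp (mstar a) a) = rnorm a ^+ 2.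
Proof. by apply: complexI; rewrite rmorphXn/= -!rnormE cstar_norm. Qed.

(** The C*-identity gives |b|^2 <= |b^*| |b|, where |b| cancels unless it is 0; replacing b by b^*
    gives the converse. *)
Lemma rnorm_star s r (a : mor s r) : rnorm (mstar a) = rnorm a.
Proof.
have le (u v : T) (b : mor u v) : rnorm b <= rnorm (mstar b).
  have := rnorm_comp (mstar b) b; rewrite rnorm_cstar expr2.
  have := rnorm_ge0 b; rewrite le_eqVlt => /predU1P[<-|b0].
    by rewrite rnorm_ge0.
  by rewrite ler_pM2r.
by apply/eqP; rewrite eq_le le andbT -[leRHS](congr1 _ (mstarK a)) le.
Qed.

(* Both norms are square roots of [rnorm (mcomp (mstar y) (y + k (k y)))]. *)
Lemma rnorm_selfadj_conj s r (k : mor s s) (y : mor s r) : mstar k = k ->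
  rnorm (y - 'i *: mcomp k y) = rnorm (y + 'i *: mcomp k y).
Proof.
move=> kk; suff E : mcomp (mstar (y - 'i *: mcomp k y)) (y - 'i *: mcomp k y) =
    mcomp (mstar (y + 'i *: mcomp k y)) (y + 'i *: mcomp k y).
  have /eqP := congr1 (@rnorm _ _) E.
  by rewrite !rnorm_cstar eqrXn2 ?rnorm_ge0// => /eqP.
rewrite !(mstarD, mstarN, mstarZ, mstar_comp) conjCi kk.
rewrite !(mcompDl, mcompDr, mcompNl, mcompNr, mcompZl, mcompZr) !mcompA.
rewrite !(scaleNr, opprK, scalerN) !scalerA.
by rewrite [LHS]addrACA [RHS]addrACA !addrA addrK subrK.
Qed.

Lemma rnormi s r (x : mor s r) : rnorm ('i *: x) = rnorm x.
Proof. by rewrite /rnorm normrZ normCi mul1r. Qed.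

(* [1 + k^2 = (1 + ik) (1 - ik)], and [2 y] is the sum of [(1 + ik) y] and
   [(1 - ik) y], which have the same norm. *)
Lemma rnorm_le_addsqr s r (k : mor s s) (y : mor s r) : mstar k = k ->
  rnorm y <= rnorm (y + mcomp k (mcomp k y)).
Proof.
move=> kk.
have le1 x : rnorm x <= rnorm (x + 'i *: mcomp k x :> mor s r).
  have := rnormD (x + 'i *: mcomp k x) (x - 'i *: mcomp k x).
  rewrite (rnorm_selfadj_conj x kk) addrACA subrr addr0.
  have -> : x + x = (2 : R)%:C%C *: x.
    by rewrite -mulr2n -scaler_nat -(rmorph_nat (real_complex R)).
  by rewrite rnormZ// => ?; lra.
have := le1 (y - 'i *: mcomp k y); rewrite (rnorm_selfadj_conj y kk).
move=> /(le_trans (le1 y)); congr (_ <= rnorm _).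
rewrite mcompDr mcompNr mcompZr scalerDr scalerN scalerA -expr2 sqrCi scaleN1r.
by rewrite opprK addrA subrK.
Qed.

(* [1 - k^4 = (1 + k^2) (1 - k^2)], so that [|(1 - k^2) z|] increases when [k]
   is replaced by [k^2], and the powers of [k] tend to 0. *)
Lemma rnorm_subsqr_le s r (k : mor s s) (z : mor s r) :
  mstar k = k -> rnorm k < 1 -> rnorm (z - mcomp k (mcomp k z)) <= rnorm z.
Proof.
move=> kk k1; pose p := fix p n := if n is m.+1 then mcomp (p m) (p m) else k.
have pp n : mstar (p n) = p n by elim: n => //= n IH; rewrite mstar_comp IH.
(* [p n] is k^(2^n); the crude exponent n + 1 already forces decay. *)
have pn n : rnorm (p n) <= rnorm k ^+ n.+1.
  elim: n => [|n IH]/=; first by rewrite expr1.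
  apply: (le_trans (rnorm_comp _ _)); rewrite exprSr.
  apply: ler_pM; rewrite ?rnorm_ge0//.
  apply: (le_trans IH); rewrite exprS ler_piMr ?rnorm_ge0//.
  by rewrite exprn_ile1 ?rnorm_ge0 ?ltW.
have incr n : rnorm (z - mcomp k (mcomp k z)) <= rnorm (z - mcomp (p n.+1) z).
  elim: n => [|n IH]; first by rewrite /= mcompA.
  apply: (le_trans IH); apply: (le_trans (rnorm_le_addsqr _ (pp n))).
  by rewrite mcompA -/(p n.+1) mcompDr mcompNr mcompA addrA subrK.
apply/ler_addgt0Pr => e e0.
have /cvgrPdist_lt/(_ (e / (1 + rnorm z))) : GRing.exp (rnorm k) @ \oo --> 0.
  by apply: cvg_expr; rewrite ger0_norm ?rnorm_ge0.
have z1 : 0 < 1 + rnorm z by rewrite ltr_pwDl ?rnorm_ge0.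
(* The exponent n + 2, past the threshold n, is the one that bounds [p n.+1]. *)
case=> [|n _ /(_ n.+2 (leqW (leqnSn n)))]; first exact: divr_gt0.
rewrite sub0r normrN ger0_norm ?exprn_ge0 ?rnorm_ge0// ltr_pdivlMr// => ke.
apply: (le_trans (incr n)); apply: (le_trans (rnormB _ _)); rewrite lerD2l.
apply: (le_trans (rnorm_comp _ _)); apply: le_trans (ltW ke).
by rewrite ler_pM ?rnorm_ge0// lerDr.
Qed.

(** * The operator P = 1 - h^2 and its ergodic sums *)

Definition damp s r (h : mor s s) (z : mor s r) := z - mcomp h (mcomp h z).

Definition damp_sum s r (h : mor s s) n (z : mor s r) :=
  \sum_(i < n) iter i (damp h) z.

Lemma rnorm_iter_damp s r (h : mor s s) (z : mor s r) n :
  mstar h = h -> rnorm h < 1 -> rnorm (iter n (damp h) z) <= rnorm z.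
Proof.
move=> hh h1; elim: n => //= n.
by apply: le_trans; exact: rnorm_subsqr_le.
Qed.

Lemma rnorm_damp_sum s r (h : mor s s) (z : mor s r) n :
  mstar h = h -> rnorm h < 1 -> rnorm (damp_sum h n z) <= n%:R * rnorm z.
Proof.
move=> hh h1; rewrite /damp_sum; elim: n => [|n IH].
  by rewrite big_ord0 rnorm0 mul0r.
rewrite big_ord_recr/= -natr1 mulrDl mul1r (le_trans (rnormD _ _))// lerD//.
exact: rnorm_iter_damp.
Qed.

(** The sum telescopes, since h^2 P^i = P^i - P^(i+1). *)
Lemma sqr_damp_sum s r (h : mor s s) (z : mor s r) n :
  mcomp h (mcomp h (damp_sum h n z)) = z - iter n (damp h) z.
Proof.
rewrite /damp_sum; elim: n => [|n IH]; first by rewrite big_ord0 !mcomp0r subrr.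
by rewrite big_ord_recr/= !mcompDr IH opprB addrA addrAC.
Qed.

(** Self-adjointness of h passes to 1 - h^2 and to its powers. *)
Lemma iter_damp_adj s r q (h : mor s s) (x : mor s r) (y : mor s q) n :
  mstar h = h ->
  mcomp (mstar (iter n (damp h) x)) y = mcomp (mstar x) (iter n (damp h) y).
Proof.
move=> hh; elim: n y => // n IH y; rewrite [in RHS]iterSr -IH iterS /damp.
rewrite mstarD mstarN !mstar_comp hh mcompDl mcompNl mcompDr mcompNr.
by rewrite -!mcompA.
Qed.

Lemma damp_sum_adj s r q (h : mor s s) (x : mor s r) (y : mor s q) n :
  mstar h = h ->
  mcomp (mstar (damp_sum h n x)) y = mcomp (mstar x) (damp_sum h n y).
Proof.
move=> hh; rewrite /damp_sum; elim: n => [|n IH].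
  by rewrite !big_ord0 mstar0 mcomp0l mcomp0r.
by rewrite !big_ord_recr/= mstarD mcompDl mcompDr IH iter_damp_adj.
Qed.

Lemma mstar_mulstar s r (z : mor s r) :
  mstar (mcomp z (mstar z)) = mcomp z (mstar z).
Proof. by rewrite mstar_comp mstarK. Qed.

Lemma rnorm_mulstar s r (z : mor s r) :
  rnorm (mcomp z (mstar z)) = rnorm z ^+ 2.
Proof. by rewrite -[X in mcomp X _]mstarK rnorm_cstar rnorm_star. Qed.

(* With [Y = damp_sum z] and [W = damp_sum Y], self-adjointness of [damp_sum]
   gives [|Y|^2 = |z^* W|]; and [|h (h W)| <= 2 |Y|] because the sum telescopes. *)
Lemma rnorm_damp_sum_mulstar s r (z : mor s r) n : rnorm z < 1 ->
  rnorm (damp_sum (mcomp z (mstar z)) n z) ^+ 8 <= 2 * n%:R ^+ 7.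
Proof.
move=> z1; set h := mcomp z (mstar z).
have hh : mstar h = h by exact: mstar_mulstar.
have h1 : rnorm h < 1 by rewrite rnorm_mulstar exprn_ilt1 ?rnorm_ge0.
set Y := damp_sum h n z; pose W := damp_sum h n Y.
have n0 : 0 <= n%:R :> R by [].
have Yn : rnorm Y <= n%:R.
  apply: (le_trans (rnorm_damp_sum _ _ hh h1)).
  by rewrite ler_piMr// ltW.
have Wn : rnorm W <= n%:R ^+ 2.
  apply: (le_trans (rnorm_damp_sum _ _ hh h1)).
  by rewrite expr2 ler_wpM2l.
have hhW : rnorm (mcomp h (mcomp h W)) <= 2 * n%:R.
  rewrite sqr_damp_sum (le_trans (rnormB _ _))//.
  by have := rnorm_iter_damp Y n hh h1; lra.
(* Since |hW|^2 = |W^* h h W| and |z^* W|^2 = |W^* h W|, the bound on h (h W) descends to hW and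
   then to z^* W. *)
have hW : rnorm (mcomp h W) ^+ 2 <= n%:R ^+ 2 * (2 * n%:R).
  rewrite -rnorm_cstar mstar_comp hh -mcompA.
  by rewrite (le_trans (rnorm_comp _ _))// rnorm_star ler_pM ?rnorm_ge0.
have zW : rnorm (mcomp (mstar z) W) ^+ 2 <= n%:R ^+ 2 * rnorm (mcomp h W).
  rewrite -rnorm_cstar mstar_comp mstarK -mcompA [mcomp z _]mcompA.
  by rewrite (le_trans (rnorm_comp _ _))// rnorm_star ler_wpM2r ?rnorm_ge0.
have -> : rnorm Y ^+ 8 = (rnorm (mcomp (mstar z) W) ^+ 2) ^+ 2.
  rewrite /W -damp_sum_adj// rnorm_cstar -!exprM //.
have -> : 2 * n%:R ^+ 7 = (n%:R ^+ 2) ^+ 2 * (n%:R ^+ 2 * (2 * n%:R)) :> R by ring.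
apply: (@le_trans _ _ ((n%:R ^+ 2 * rnorm (mcomp h W)) ^+ 2)).
  by rewrite lerXn2r ?nnegrE ?mulr_ge0 ?exprn_ge0 ?rnorm_ge0.
by rewrite exprMn ler_wpM2l ?exprn_ge0.
Qed.

(** * Closed subspaces and the membership criterion *)

Lemma closed_subspaceZ (V : normedModType R[i]) (M : set V) c x :
  closed_subspace M -> M x -> M (c *: x).
Proof. by case=> M0 Ml _ Mx; rewrite -[_ *: _]addr0; exact: Ml. Qed.

Lemma closed_subspaceD (V : normedModType R[i]) (M : set V) x y :
  closed_subspace M -> M x -> M y -> M (x + y).
Proof. by case=> M0 Ml _ Mx My; rewrite -[x]scale1r; exact: Ml. Qed.

Lemma mem_of_mulstar s r (M : set (mor s r)) (z : mor s r) :
  closed_subspace M ->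
  (forall x : mor s r, M (mcomp (mcomp z (mstar z)) x)) -> M z.
Proof.
move=> Msub; have [M0 _ /closed_approx clM] := Msub.
(* Scaling z by 1 / (1 + |z|) preserves the hypothesis, and scaling back preserves membership in
   M. *)
wlog z1 : z / rnorm z < 1.
  move=> H Mz; pose t := (1 + rnorm z)^-1.
  have z1 : 0 < 1 + rnorm z by rewrite ltr_pwDl ?rnorm_ge0.
  have t0 : 0 < t by rewrite invr_gt0.
  have tC : t%:C%C != 0 by rewrite (inj_eq (@complexI R) t 0) gt_eqF.
  rewrite -[z](@scalerK _ _ t%:C%C) ?tC//.
  apply: closed_subspaceZ => //; apply: H.
    by rewrite rnormZ ?ltW// /t mulrC ltr_pdivrMr// mul1r; lra.
  move=> x; rewrite mstarZ mcompZl mcompZr !mcompZl scalerA.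
  exact: closed_subspaceZ.
move=> Mz; apply: clM => e e0; set h := mcomp z (mstar z).
(* Consecutive terms differ by h (h (P^i z)), which lies in M by hypothesis. *)
have Mi i : M (z - iter i (damp h) z).
  elim: i => [|i IH]; first by rewrite subrr.
  by rewrite /= opprB addrCA addrC; exact: closed_subspaceD.
(* This n gives 2 n^7 < (e n)^8, so the average of the P^i z has norm below e. *)
pose n := (Num.truncn (2 / e ^+ 8)).+1.
have n0 : 0 < n%:R :> R by [].
have ne : 2 < e ^+ 8 * n%:R by rewrite mulrC -ltr_pdivrMr ?exprn_gt0// truncnS_gt.
(* This element of M differs from z exactly by the average of the P^i z. *)
exists (((n%:R)^-1)%:C%C *: \sum_(i < n) (z - iter i (damp h) z)).
  apply: closed_subspaceZ => //; elim/big_ind : _ => // x y.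
  exact: closed_subspaceD.
rewrite sumrB sumr_const card_ord scalerBr -[z *+ n]scaler_nat scalerA.
rewrite fmorphV rmorph_nat mulVf ?pnatr_eq0// scale1r opprB addrC subrK.
rewrite -(rmorph_nat (@real_complex R)) -fmorphV rnormZ ?invr_ge0//.
rewrite mulrC ltr_pdivrMr// -(@ltr_pXn2r _ 8) ?nnegrE ?rnorm_ge0 ?mulr_ge0 ?ltW//.
apply: (le_lt_trans (rnorm_damp_sum_mulstar n z1)).
by rewrite exprMn [n%:R ^+ 8]exprS mulrA ltr_pM2r// exprn_gt0.
Qed.

Lemma closed_subspace_mull t s r (a : mor t s) (M : set (mor t r)) :
  closed_subspace M -> closed_subspace [set x : mor s r | M (mcomp a x)].
Proof.
case=> M0 Ml /closed_approx clM; split=> /=; first by rewrite mcomp0r.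
  by move=> c x y Mx My; rewrite mcompDr mcompZr; exact: Ml.
apply/closed_approx => z zM; apply: clM => e e0.
(* Adding 1 keeps the divisor positive when a = 0. *)
have a1 : 0 < rnorm a + 1 by rewrite ltr_wpDl ?rnorm_ge0.
have [|m Mm zm] := zM (e / (rnorm a + 1)); first exact: divr_gt0.
exists (mcomp a m) => //; rewrite -mcompNr -mcompDr.
apply: (le_lt_trans (rnorm_comp _ _)); move: zm; rewrite ltr_pdivlMr//.
by apply: le_lt_trans; rewrite mulrC ler_wpM2l ?rnorm_ge0// lerDl.
Qed.

Lemma closed_subspace_mulr t s r (b : mor s r) (M : set (mor t r)) :
  closed_subspace M -> closed_subspace [set x : mor t s | M (mcomp x b)].
Proof.
case=> M0 Ml /closed_approx clM; split=> /=; first by rewrite mcomp0l.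
  by move=> c x y Mx My; rewrite mcompDl mcompZl; exact: Ml.
apply/closed_approx => z zM; apply: clM => e e0.
have b1 : 0 < rnorm b + 1 by rewrite ltr_wpDl ?rnorm_ge0.
have [|m Mm zm] := zM (e / (rnorm b + 1)); first exact: divr_gt0.
exists (mcomp m b) => //; rewrite -mcompNl -mcompDl.
apply: (le_lt_trans (rnorm_comp _ _)); move: zm; rewrite ltr_pdivlMr//.
by apply: le_lt_trans; rewrite ler_wpM2l ?rnorm_ge0// lerDl.
Qed.

Lemma closed_subspace_forall (J : Type) (V : normedModType R[i])
    (M : J -> set V) :
  (forall j, closed_subspace (M j)) -> closed_subspace [set x | forall j, M j x].
Proof.
move=> cM; split=> /=.
- by move=> j; case: (cM j).
- by move=> c x y Mx My j; case: (cM j) => _ Ml _; exact: Ml.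
- apply/closed_approx => z zM j; case: (cM j) => _ _ /closed_approx; apply=> e e0.
  by have [m Mm zm] := zM e e0; exists m.
Qed.

(** * Ideals and the two descriptions of their elements *)

(** For z = c^*, every z z^* x = c^* c x lies in I, so [mem_of_mulstar] applies to z. *)
Lemma closed_two_sided_ideal_star r (I : set (mor r r)) (c : mor r r) :
  closed_two_sided_ideal I -> I c -> I (mstar c).
Proof.
case=> subI Il Ir Ic; apply: mem_of_mulstar => // x.
by rewrite mstarK; apply: Ir; exact: Il.
Qed.

(** The criterion is applied to the closed subspace of all x with x b in I; it contains every a a^*
    x. *)
Lemma mulstar_mem_comp s r (I : set (mor s s)) (a : mor s r) (b : mor r s) :
  closed_two_sided_ideal I -> I (mcomp a (mstar a)) -> I (mcomp a b).
Proof.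
case=> subI Il Ir Ia.
apply: (mem_of_mulstar (closed_subspace_mulr b subI)) => x /=.
by rewrite -mcompA; exact: Ir.
Qed.

(** Taking adjoints reduces this to [mulstar_mem_comp] for a^*, as I is stable under the
    involution. *)
Lemma starmul_mem_comp s r (I : set (mor r r)) (a : mor s r) (b : mor r s) :
  closed_two_sided_ideal I -> I (mcomp (mstar a) a) -> I (mcomp b a).
Proof.
move=> idI Ia; rewrite -[mcomp b a]mstarK mstar_comp.
apply: closed_two_sided_ideal_star => //; apply: mulstar_mem_comp => //.
by rewrite mstarK.
Qed.

(** For the converse, the criterion is applied to M = K(s,r), which contains a a^* x for every x. *)
Lemma ideal_mulstar (K : forall s r : T, set (mor s r)) s r (a : mor s r) :
  is_ideal K -> K s r a <-> K s s (mcomp a (mstar a)).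
Proof.
case=> subK Kl Kr; split=> [Ka|Ka]; first exact: Kr.
by apply: mem_of_mulstar => // x; exact: Kr.
Qed.

Lemma ideal_star (K : forall s r : T, set (mor s r)) s r (a : mor s r) :
  is_ideal K -> K s r a -> K r s (mstar a).
Proof.
move=> idK Ka; apply/(ideal_mulstar _ idK); rewrite mstarK.
by case: idK => _ Kl _; exact: Kl.
Qed.

Lemma ideal_starmul (K : forall s r : T, set (mor s r)) s r (a : mor s r) :
  is_ideal K -> K s r a <-> K r r (mcomp (mstar a) a).
Proof.
move=> idK; rewrite -[X in mcomp _ X]mstarK -ideal_mulstar//.
by split=> /(ideal_star idK)//; rewrite mstarK.
Qed.

Lemma ideal_of_diagonal (K0 : forall r : T, set (mor r r)) :
  (forall r, closed_two_sided_ideal (K0 r)) ->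
  (forall s r : T, [set a : mor s r | K0 r (mcomp (mstar a) a)]
     = [set a | K0 s (mcomp a (mstar a))]) ->
  is_ideal (fun s r : T => [set a : mor s r | K0 r (mcomp (mstar a) a)]).
Proof.
move=> idK0 K0E.
have KE s r : [set a : mor s r | K0 r (mcomp (mstar a) a)] =
    [set a | forall b : mor r s, K0 r (mcomp b a)].
  by apply/seteqP; split=> a /= Ka => [b|]; [exact: starmul_mem_comp|exact: Ka].
have KE' s r : [set a : mor s r | K0 r (mcomp (mstar a) a)] =
    [set a | forall b : mor r s, K0 s (mcomp a b)].
  rewrite K0E; apply/seteqP; split=> a /= Ka => [b|]; last exact: Ka.
  exact: mulstar_mem_comp.
split=> [s r|t s r a b|t s r a b].
(* The left form is an intersection of preimages of [K0 r] under left compositions. *)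
- rewrite KE; apply: closed_subspace_forall => b.
  by apply: closed_subspace_mull; case: (idK0 r).
- by rewrite !KE /= => Kb c; rewrite mcompA; exact: Kb.
- by rewrite !KE' /= => Ka c; rewrite -mcompA; exact: Ka.
Qed.

Lemma closed_two_sided_ideal_starmul r (I : set (mor r r)) (a : mor r r) :
  closed_two_sided_ideal I -> I (mcomp (mstar a) a) <-> I a.
Proof.
move=> idI; have [subI Il Ir] := idI; split=> Ia; last exact: Il.
rewrite -[a]mstarK; apply: closed_two_sided_ideal_star => //.
by apply: mem_of_mulstar => // x; rewrite mstarK; exact: Ir.
Qed.

End Precategory.

Theorem theorem2p6 (R : realType) (T : cstar_precategory R) :
  (forall K : forall s r : T, set (mor s r), is_ideal K ->
     forall s r : T,
       K s r = [set a | K r r (mcomp (mstar a) a)]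
       /\ [set a : mor s r | K r r (mcomp (mstar a) a)]
          = [set a | K s s (mcomp a (mstar a))])
  /\
  (forall K0 : forall r : T, set (mor r r),
     (forall r : T, closed_two_sided_ideal (K0 r)) ->
     (forall s r : T,
        [set a : mor s r | K0 r (mcomp (mstar a) a)]
        = [set a | K0 s (mcomp a (mstar a))]) ->
     exists K : forall s r : T, set (mor s r),
       [/\ is_ideal K,
           forall r : T, K r r = K0 r
         & forall s r : T,
             K s r = [set a | K r r (mcomp (mstar a) a)]
             /\ [set a : mor s r | K r r (mcomp (mstar a) a)]
                = [set a | K s s (mcomp a (mstar a))]]).
Proof.
split=> [K idK s r|K0 idK0 K0E].
  have E1 : K s r = [set a | K r r (mcomp (mstar a) a)].
    by apply/seteqP; split=> a /=; rewrite -ideal_starmul.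
  split=> //; rewrite -E1.
  by apply/seteqP; split=> a /=; rewrite -ideal_mulstar.
pose K s r := [set a : mor s r | K0 r (mcomp (mstar a) a)].
(* Agreement on the diagonal turns the relations for [K0] into those required of [K]. *)
have KK0 r : K r r = K0 r.
  by apply/seteqP; split=> a; case: (closed_two_sided_ideal_starmul a (idK0 r)).
by exists K; split=> // [|s r]; [exact: ideal_of_diagonal|rewrite !KK0].
Qed.
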